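(* Let $X$ be a set of size $n$, choose $M$ subsets $S_1,\dots,S_M$ of $X$ of size $k$ by uniform sampling without replacement, let $p\le k$, and let $A$ be the event that every set of $p$ points $\{x_1,\dots,x_p\}\subseteq X$ is contained in at least one $S_i$. For any $\epsilon\in(0,1)$, if $$M\ge\left(p\log\left(\frac{ne}{p}\right)-\log(1-\epsilon)\right)\left(\frac{n-p+1}{k-p+1}\right)^{p},$$ then $P(A)\ge\epsilon$.
   Context: Here $1\le p\le k\le n$ and $M\geq 1$ are integers, $\log$ is the natural logarithm and $e$ its base. ''Uniform sampling without replacement'' refers to the $k$ elements within each subset: the $S_i$ are independent, each uniformly distributed among all $k$-element subsets of $X$. *)

(* Defs.v *)
From HB Require Import structures.
From mathcomp Require Import all_boot all_order all_algebra.
From mathcomp Require Import all_classical all_reals all_analysis.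

Set Implicit Arguments.
Unset Strict Implicit.
Unset Printing Implicit Defensive.

Import Order.TTheory GRing.Theory Num.Theory.
Local Open Scope classical_set_scope.
Local Open Scope ring_scope.

(* Measurability for the discrete sigma-algebra on the finite type [U]; for
   finite [U] it suffices to consider fibers. *)
Definition random_element d (T : measurableType d) (U : finType) (Y : T -> U)
    : Prop :=
  forall u : U, measurable [set w | Y w = u].

(* Mutual independence: the product rule holds over every subfamily [J] of
   indices and for all events [E i] in the (discrete) target space. *)
Definition independent_family d (T : measurableType d) (R : realType)
    (P : probability T R) (I U : finType) (Y : I -> T -> U) : Prop :=
  forall (J : {set I}) (E : I -> {set U}),
    P [set w | forall i, i \in J -> Y i w \in E i] =
      (\prod_(i in J) P [set w | Y i w \in E i])%E.

Definition uniform_ksubset d (T : measurableType d) (R : realType)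
    (P : probability T R) (X : finType) (k : nat) (S : T -> {set X}) : Prop :=
  forall B : {set X},
    P [set w | S w = B] =
      (if #|B| == k then ('C(#|X|, k)%:R)^-1 else 0 : R)%:E.

Definition all_covered (T : Type) (X : finType) (M p : nat)
    (S : 'I_M -> T -> {set X}) : set T :=
  [set w | forall Z : {set X}, #|Z| = p -> exists i : 'I_M, Z \subset S i w].

(* Main.v *)
(** Union bound over the [p]-subsets [Z]. A uniform [k]-subset contains [Z] with
    probability [C(n-p, k-p) / C(n, k) = k ^_ p / n ^_ p], which is at least
    [r = ((k-p+1) / (n-p+1)) ^ p] because
    [(k-i) / (n-i)] is smallest at [i = p-1]. By independence some [Z] is missed
    by all [S i] with probability at most
    [C(n, p) (1-r)^M <= (n e / p)^p exp (- r M) <= 1 - eps]. *)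

Require Import Defs.
From HB Require Import structures.
From mathcomp Require Import all_boot all_order all_algebra.
From mathcomp Require Import all_classical all_reals all_analysis.
From mathcomp Require Import zify.

Set Implicit Arguments.
Unset Strict Implicit.
Unset Printing Implicit Defensive.

Import Order.TTheory GRing.Theory Num.Theory.
Local Open Scope classical_set_scope.
Local Open Scope ring_scope.

(** After multiplication by [(k - p)! (n - k)!] both sides become [n!]. This turns the containment
    probability [C(n-p, k-p) / C(n, k)] into [k ^_ p / n ^_ p]. *)
Lemma mul_bin_ffact (n k p : nat) : (p <= k)%N -> (k <= n)%N ->
  ('C(n, k) * k ^_ p = 'C(n - p, k - p) * n ^_ p)%N.
Proof.
move=> pk kn.
have e1 := bin_fact kn; have := bin_fact (leq_sub2r p kn).
have -> : (n - p - (k - p) = n - k)%N by lia.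
have e2 := ffact_fact pk; have e3 := ffact_fact (leq_trans pk kn) => e4.
apply/eqP; rewrite -(eqn_pmul2r (fact_gt0 (k - p))).
rewrite -(eqn_pmul2r (fact_gt0 (n - k))).
by rewrite -(mulnA 'C(n, k)) e2 -mulnA e1 -e3 -e4; apply/eqP; lia.
Qed.

Lemma leq_expn_ffact (n k p : nat) : (p <= k)%N -> (k <= n)%N ->
  ((k - p).+1 ^ p * n ^_ p <= (n - p).+1 ^ p * k ^_ p)%N.
Proof.
move=> pk kn; rewrite !ffact_prod.
have cst c : (c ^ p = \prod_(i < p) c)%N by rewrite prod_nat_const card_ord.
rewrite !cst -!big_split /=; apply: leq_prod => i _.
have ip := ltn_ord i.
(* Factor by factor the claim is [K (N + a) <= N (K + a)], that is [K a <= N a], which follows from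
   [K <= N]. *)
set K := (k - p).+1; set N := (n - p).+1; set a := (p - i.+1)%N.
have -> : (n - i = N + a)%N by rewrite /N /a; lia.
have -> : (k - i = K + a)%N by rewrite /K /a; lia.
rewrite !mulnDr mulnC leq_add2l leq_mul2r; apply/orP; right; rewrite /K /N; lia.
Qed.

(** Adding [Z] to a subset of its complement is injective, since removing [Z] again recovers the
    subset. *)
Lemma card_supersets_ge (X : finType) (Z : {set X}) (k : nat) : (#|Z| <= k)%N ->
  ('C(#|X| - #|Z|, k - #|Z|)
     <= #|[set B : {set X} | (Z \subset B) && (#|B| == k)]%SET|)%N.
Proof.
move=> Zk; have <- : #|~: Z| = (#|X| - #|Z|)%N by rewrite -(cardsC Z) addKn.
rewrite -cards_draws.
rewrite -(@card_in_imset _ _ (fun A : {set X} => A :|: Z)); last first.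
  move=> A B; rewrite !inE => /andP[AZ _] /andP[BZ _].
  move=> /(congr1 (fun C => C :\: Z)).
  rewrite !finset.setDUl !finset.setDv !finset.setU0.
  move: AZ BZ; rewrite -!finset.disjoints_subset.
  by move=> /finset.setDidPl -> /finset.setDidPl ->.
apply/subset_leq_card/fintype.subsetP => B /imsetP[A]; rewrite inE.
move=> /andP[AZ /eqP cA] ->.
rewrite inE finset.subsetUr cardsU cA.
move: AZ; rewrite -finset.disjoints_subset -setI_eq0 => /eqP ->.
by rewrite cards0 subn0 subnK ?eqxx.
Qed.

Section ExpBounds.
Variable R : realType.

(** Induction on [p]: the passage to [p + 1] costs a factor [(1 + 1/p)^p <= e], a consequence of
    [1 + x <= exp x] at [x = 1/p]. *)
Lemma expn_le_expR_fact (p : nat) : p%:R ^+ p <= expR p%:R * p`!%:R :> R.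
Proof.
elim: p => [|p IH]; first by rewrite expr0 expR0 mulr1.
have [->|p0] := posnP p.
  by rewrite expr1 mulr1; apply: le_trans (expR_ge1Dx _); rewrite lerDr.
have p0' : 0 < p%:R :> R by rewrite ltr0n.
have step : p.+1%:R ^+ p <= p%:R ^+ p * expR 1 :> R.
  have -> : expR 1 = expR (p%:R^-1 : R) ^+ p.
    by rewrite -expRM_natl mulfV // gt_eqF.
  rewrite -exprMn; apply: lerXn2r;
    rewrite ?nnegrE ?mulr_ge0 ?expR_ge0 ?ler0n //.
  apply: le_trans (ler_wpM2l (ltW p0') (expR_ge1Dx _)).
  by rewrite mulrDr mulr1 mulfV ?gt_eqF // -natr1.
rewrite exprS factS natrM mulrCA ler_pM2l ?ltr0n //.
apply: (le_trans step); rewrite -[p.+1%:R]natr1 expRD mulrAC.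
by rewrite ler_wpM2r ?expR_ge0.
Qed.

(** Combines [C(n, p) p! = n ^_ p <= n^p] with [p^p <= e^p p!]. *)
Lemma bin_le_expn (n p : nat) : (0 < p)%N ->
  'C(n, p)%:R <= (n%:R * expR 1 / p%:R) ^+ p :> R.
Proof.
move=> p0; have p0' : 0 < p%:R :> R by rewrite ltr0n.
rewrite expr_div_n ler_pdivlMr ?exprn_gt0 //.
apply: le_trans (ler_wpM2l (ler0n _ _) (expn_le_expR_fact p)) _.
rewrite exprMn -expRM_natl mulr1 mulrCA [leRHS]mulrC ler_wpM2l ?expR_ge0 //.
rewrite -natrM -natrX ler_nat bin_ffact ffact_prod -[p in leqRHS]card_ord.
by rewrite -prod_nat_const; apply: leq_prod => i _; exact: leq_subr.
Qed.

Lemma bin_exp_le (n p M : nat) (r eps : R) :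
  (0 < p)%N -> (0 < n)%N -> 0 < r -> r <= 1 -> eps < 1 ->
  (p%:R * ln (n%:R * expR 1 / p%:R) - ln (1 - eps)) / r <= M%:R ->
  'C(n, p)%:R * (1 - r) ^+ M <= 1 - eps.
Proof.
move=> p0 n0 r0 r1 eps1; rewrite ler_pdivrMr // [leRHS]mulrC => rM.
have e1 : 0 < 1 - eps by rewrite subr_gt0.
have b0 : 0 < n%:R * expR 1 / p%:R :> R.
  by rewrite divr_gt0 ?mulr_gt0 ?expR_gt0 // ltr0n.
have le1 : (1 - r) ^+ M <= expR (- (r * M%:R)).
  rewrite -mulNr expRM_natr lerXn2r ?nnegrE ?expR_ge0 ?subr_ge0 //.
  exact: expR_ge1Dx.
have le2 : expR (- (r * M%:R)) <= (1 - eps) / (n%:R * expR 1 / p%:R) ^+ p.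
  (* With the right side written as the exponential of its logarithm, comparing exponents gives
     exactly the hypothesis on [M]. *)
  rewrite -[leRHS]lnK ?posrE ?divr_gt0 ?exprn_gt0 // ler_expR.
  rewrite ln_div ?posrE ?exprn_gt0 // lnXn // -[ln _ *+ p]mulr_natl.
  by rewrite lerNl opprB.
apply: le_trans (ler_pM _ _ (bin_le_expn _ p0) (le_trans le1 le2)) _ => //.
  by rewrite exprn_ge0 // subr_ge0.
by rewrite mulrCA mulfV ?mulr1 // gt_eqF ?exprn_gt0.
Qed.

End ExpBounds.

Lemma lee_prode (R : realDomainType) (I : Type) (s : seq I) (Q : pred I)
    (f g : I -> \bar R) :
  (forall i, Q i -> 0 <= f i)%E -> (forall i, Q i -> f i <= g i)%E ->
  (\prod_(i <- s | Q i) f i <= \prod_(i <- s | Q i) g i)%E.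
Proof.
move=> f0 fg.
(* Nonnegativity of the partial products is carried along, because multiplying inequalities in
   [\bar R] requires it. *)
suff /andP[] : (0 <= \prod_(i <- s | Q i) f i
                  <= \prod_(i <- s | Q i) g i)%E by [].
apply: (big_ind2 (fun x y => (0 <= x <= y)%E)); first by rewrite lee01 lexx.
  move=> x1 x2 y1 y2 /andP[? ?] /andP[? ?].
  by rewrite mule_ge0 //= lee_pmul.
by move=> i Qi; rewrite f0 // fg.
Qed.

Section Covering.
Variables (R : realType) (d : measure_display) (T : measurableType d).

Lemma random_element_preimage (U : finType) (Y : T -> U) (E : {set U}) :
  [set w | Y w \in E] = \bigcup_(u in [set` E]) [set w | Y w = u].
Proof.
by apply/seteqP; split => [w wE|w [u uE /= ->]//]; exists (Y w).
Qed.

Lemma measurable_random_element (U : finType) (Y : T -> U) (E : {set U}) :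
  random_element Y -> measurable [set w | Y w \in E].
Proof.
move=> mY; rewrite random_element_preimage.
by apply: fin_bigcup_measurable => [|u _]; [exact: finite_finpred|exact: mY].
Qed.

Variable P : probability T R.

Lemma probability_random_element (U : finType) (Y : T -> U) (E : {set U}) :
  random_element Y ->
  P [set w | Y w \in E] = (\sum_(u in E) P [set w | Y w = u])%E.
Proof.
move=> mY; rewrite random_element_preimage measure_fin_bigcup //.
- apply/esym/bigfs; first exact: index_enum_uniq.
  by move=> u _; rewrite mem_index_enum.
- by move=> u v _ _ [w [/= <- <-]].
Qed.

Lemma uniform_ksubset_miss (X : finType) (k : nat) (S : T -> {set X})
    (Z : {set X}) :
  (#|Z| <= k)%N -> (k <= #|X|)%N ->
  random_element S -> uniform_ksubset P k S ->
  (P [set w | S w \in [set B : {set X} | ~~ (Z \subset B)]%SET] <=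
   (1 - ((k - #|Z|).+1%:R / (#|X| - #|Z|).+1%:R) ^+ #|Z|)%:E)%E.
Proof.
move=> Zk kX mS uS.
have -> : [set w | S w \in [set B : {set X} | ~~ (Z \subset B)]%SET]
   = ~` [set w | S w \in [set B : {set X} | Z \subset B]%SET].
  by apply/seteqP; split => w /=; rewrite !inE => /negP.
rewrite probability_setC; last exact: measurable_random_element.
rewrite EFinB leeB // probability_random_element //.
under eq_bigr do rewrite uS.
rewrite sumEFin lee_fin -big_mkcondr /= sumr_const.
rewrite -[leRHS]mulr_natl.
have C0 : 0 < 'C(#|X|, k)%:R :> R by rewrite ltr0n bin_gt0.
rewrite ler_pdivlMr // expr_div_n mulrAC ler_pdivrMr ?exprn_gt0 //.
rewrite -!natrX -!natrM ler_nat.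
have ZX := leq_trans Zk kX.
(* Denominators are cleared, leaving a count of naturals. The extra factor [n ^_ p] lets
   [leq_expn_ffact] and then [mul_bin_ffact] apply, which reduces the claim to the number of
   [k]-supersets of [Z]. *)
rewrite -(@leq_pmul2r (#|X| ^_ #|Z|)) ?ffact_gt0 //.
apply: (@leq_trans ((#|X| - #|Z|).+1 ^ #|Z| * k ^_ #|Z| * 'C(#|X|, k))%N).
  by rewrite mulnAC leq_mul2r leq_expn_ffact ?orbT.
rewrite -mulnA [(k ^_ _ * _)%N]mulnC mul_bin_ffact //.
rewrite mulnCA !mulnA !leq_mul2r; apply/orP; right; apply/orP; right.
apply: leq_trans (card_supersets_ge Zk) _.
by apply/eq_leq/eq_card => B; rewrite inE [RHS]unfold_in inE.
Qed.

End Covering.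

Theorem proposition28 (R : realType) (d : measure_display)
    (T : measurableType d) (P : probability T R)
    (X : finType) (n k p M : nat) (S : 'I_M -> T -> {set X}) (eps : R)
    (hX : #|X| = n)
    (hp : (1 <= p)%N) (hpk : (p <= k)%N) (hkn : (k <= n)%N) (hM : (1 <= M)%N)
    (hmeas : forall i, random_element (S i))
    (hunif : forall i, uniform_ksubset P k (S i))
    (hindep : independent_family P S)
    (heps0 : 0 < eps) (heps1 : eps < 1)
    (hbound : (p%:R * ln (n%:R * expR 1 / p%:R) - ln (1 - eps))
                * ((n%:R - p%:R + 1) / (k%:R - p%:R + 1)) ^+ p <= M%:R) :
  (eps%:E <= P (all_covered p S))%E.
Proof.
pose E (Z : {set X}) := [set B : {set X} | ~~ (Z \subset B)]%SET.
(* The event that every [S i] misses [Z], with the full index set spelled out so that [hindep]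
   rewrites its probability directly into a product. *)
pose U Z := [set w | forall i, i \in [set: 'I_M]%SET -> S i w \in E Z].
pose r : R := ((k - p).+1%:R / (n - p).+1%:R) ^+ p.
have mU Z : measurable (U Z).
  have -> : U Z = \bigcap_(i in [set: 'I_M]) [set w | S i w \in E Z].
    by apply/seteqP; split => [w wU i _|w wU i _]; apply: wU => //; rewrite inE.
  apply: fin_bigcap_measurable => // i _.
  exact: measurable_random_element.
have r0 : 0 < r by rewrite exprn_gt0 // divr_gt0 ?ltr0n.
have r1 : r <= 1.
  rewrite exprn_ile1 ?divr_ge0 // ler_pdivrMr ?ltr0n // mul1r ler_nat ltnS.
  exact: leq_sub2r.
have PU (Z : {set X}) : #|Z| = p -> (P (U Z) <= ((1 - r) ^+ M)%:E)%E.
  move=> cZ; rewrite hindep.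
  have -> : (1 - r) ^+ M = \prod_(i in [set: 'I_M]%SET) (1 - r).
    by rewrite prodr_const cardsT card_ord.
  rewrite -prodEFin; apply: lee_prode => i _; first exact: measure_ge0.
  have := uniform_ksubset_miss (k := k) (Z := Z).
  by rewrite /r cZ hX; apply.
pose Zs := [set Z : {set X} | #|Z| == p]%SET.
have cov : all_covered p S = ~` \bigcup_(Z in [set` Zs]) U Z.
  apply/seteqP; split => w /=.
    move=> wA [Z]; rewrite /= inE => /eqP /wA [i Zi] /(_ i).
    by rewrite !inE Zi => /(_ isT).
  move=> nU Z cZ; apply: contrapT => nZ; apply: nU.
  exists Z; first by rewrite /= inE cZ.
  by move=> i _; rewrite inE; apply/negP => Zi; apply: nZ; exists i.
have fin := finite_finpred Zs.
have mB : measurable (\bigcup_(Z in [set` Zs]) U Z).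
  exact: fin_bigcup_measurable.
rewrite cov probability_setC // leeBrDr ?fin_num_measure //.
rewrite -leeBrDl // -EFinB.
(* The goal is now that the union of the [U Z] has probability at most [1 - eps]. Subadditivity
   bounds it by a sum of [C(n, p)] terms, each at most [(1 - r)^M]. *)
apply: le_trans
  (content_sub_fsum P fin (fun Z _ => mU Z) mB (fun w h => h)) _.
rewrite -(bigfs _ (P := fun Z => Z \in Zs) (index_enum_uniq _)); last first.
  by move=> Z _; rewrite mem_index_enum.
apply: (@le_trans _ _ (\sum_(Z in Zs) ((1 - r) ^+ M)%:E)%E).
    by apply: lee_sum => Z; rewrite inE => /eqP; exact: PU.
rewrite sumEFin lee_fin sumr_const card_draws hX -mulr_natl.
(* The truncated subtractions in [r] agree with the real ones in [hbound] because [p <= k <= n]. *)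
have rV : r^-1 = ((n%:R - p%:R + 1) / (k%:R - p%:R + 1)) ^+ p.
  by rewrite /r -exprVn invf_div -!natr1 !natrB // (leq_trans hpk).
by apply: bin_exp_le; rewrite ?rV //; lia.
Qed.
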